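(* Let $G$ be a graph of order $n$. Then $IC(G)=3$ if and only if $G\simeq K_3$, or $n\ge 3$ and $G\simeq K_{1,n-1}$, or $G\in\mathcal{B}_2$.
   Context: Graphs are finite and simple with nonempty vertex set. $K_n$ is the complete graph of order $n$, $\overline{K}_m$ is the edgeless graph of order $m$, $K_{1,n-1}$ is the star of order $n$, $\delta(H)$ is the minimum degree of $H$, and $\cup$ between graphs denotes disjoint union. A set $S$ of vertices is dominating if every vertex is in $S$ or adjacent to a vertex of $S$; it is independent if its vertices are pairwise nonadjacent; an independent dominating set is a set that is both independent and dominating. An idomatic partition of a graph is a partition of its vertex set into independent dominating sets; the idomatic number $id(H)$ is the maximum number of classes of an idomatic partition of $H$. $\mathcal{B}_2$ denotes the family of graphs (up to isomorphism) of the form $H\cup\overline{K}_m$, where $m\ge 1$ and $H$ is a bipartite graph with $\delta(H)\ge 1$ and $id(H)=2$. An independent coalition in $G$ consists of two disjoint independent sets of vertices $V_1,V_2$, neither of which is an independent dominating set but whose union $V_1\cup V_2$ is an independent dominating set; one says that $V_1$ and $V_2$ form an independent coalition. An $ic$-partition of $G$ is a partition $\pi=\{V_1,\dots,V_k\}$ of $V(G)$ into nonempty sets such that every $V_i\in\pi$ either is a singleton dominating set (a dominating set of cardinality 1), or is not an independent dominating set but forms an independent coalition with another set $V_j\in\pi$. The independent coalition number $IC(G)$ is the maximum number of classes of an $ic$-partition of $G$; the assertion $IC(G)=t$ includes that $G$ has an $ic$-partition. *)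

(* Defs.v *)
From mathcomp Require Import all_boot.

Set Implicit Arguments.
Unset Strict Implicit.
Unset Printing Implicit Defensive.

(* The vertex set may be empty here, so that all the constructions below are
   total; nonemptiness is a hypothesis wherever a graph is quantified over. *)
Record sgraph := SGraph {
  vertex :> finType;
  adj : rel vertex;
  adj_sym : symmetric adj;
  adj_irrefl : irreflexive adj
}.

Definition graph_iso (G H : sgraph) : Prop :=
  exists2 f : G -> H, bijective f & forall x y, adj (f x) (f y) = adj x y.

Section Constructions.

Definition complete_rel n : rel 'I_n := fun i j => i != j.
Lemma complete_sym n : symmetric (@complete_rel n).
Proof. by move=> i j; rewrite /complete_rel eq_sym. Qed.
Lemma complete_irrefl n : irreflexive (@complete_rel n).
Proof. by move=> i; rewrite /complete_rel eqxx. Qed.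
Definition complete n : sgraph :=
  SGraph (@complete_sym n) (@complete_irrefl n).

Definition edgeless_rel m : rel 'I_m := fun _ _ => false.
Lemma edgeless_sym m : symmetric (@edgeless_rel m).
Proof. by []. Qed.
Lemma edgeless_irrefl m : irreflexive (@edgeless_rel m).
Proof. by []. Qed.
Definition edgeless m : sgraph :=
  SGraph (@edgeless_sym m) (@edgeless_irrefl m).

Definition complete_bip_rel p q : rel ('I_p + 'I_q)%type := fun u v =>
  match u, v with
  | inl _, inr _ | inr _, inl _ => true
  | _, _ => false
  end.
Lemma complete_bip_sym p q : symmetric (@complete_bip_rel p q).
Proof. by move=> [?|?] [?|?]. Qed.
Lemma complete_bip_irrefl p q : irreflexive (@complete_bip_rel p q).
Proof. by case. Qed.
Definition complete_bip p q : sgraph :=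
  SGraph (@complete_bip_sym p q) (@complete_bip_irrefl p q).

Definition disjoint_union_rel (G H : sgraph) : rel (G + H)%type := fun u v =>
  match u, v with
  | inl x, inl y => adj x y
  | inr x, inr y => adj x y
  | _, _ => false
  end.
Lemma disjoint_union_sym G H : symmetric (@disjoint_union_rel G H).
Proof. by move=> [x|x] [y|y] //=; apply: adj_sym. Qed.
Lemma disjoint_union_irrefl G H : irreflexive (@disjoint_union_rel G H).
Proof. by move=> [x|x] /=; apply: adj_irrefl. Qed.
Definition disjoint_union (G H : sgraph) : sgraph :=
  SGraph (@disjoint_union_sym G H) (@disjoint_union_irrefl G H).

End Constructions.

Section Invariants.

Variable G : sgraph.
Implicit Types (x y : G) (A B S : {set G}) (P : {set {set G}}).

Definition degree x : nat := #|[set y | adj x y]|.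

(* Every degree is less than #|G|, so the default value is irrelevant when G
   has a vertex. *)
Definition min_degree : nat := \big[minn/#|G|]_(x : G) degree x.

Definition dominating S : bool :=
  [forall x, (x \in S) || [exists y in S, adj x y]].

Definition independent S : bool :=
  [forall x in S, forall y in S, ~~ adj x y].

Definition independent_dominating S : bool := independent S && dominating S.

Definition bipartite : Prop :=
  exists A : {set G}, independent A /\ independent (~: A).

Definition idomatic_partition P : bool :=
  partition P [set: G] && [forall A in P, independent_dominating A].

(* On a nonempty graph every partition has at least one class, so the value 0
   means that there is no idomatic partition; likewise for [IC]. *)
Definition id_number : nat := \max_(P | idomatic_partition P) #|P|.

Definition independent_coalition A B : bool :=
  [&& [disjoint A & B], independent A, independent B,
      ~~ independent_dominating A, ~~ independent_dominating B
    & independent_dominating (A :|: B)].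

Definition ic_partition P : bool :=
  partition P [set: G] &&
  [forall A in P,
     (#|A| == 1) && dominating A
  || ~~ independent_dominating A &&
       [exists B in P, (B != A) && independent_coalition A B]].

Definition IC : nat := \max_(P | ic_partition P) #|P|.

End Invariants.

Definition in_B2 (G : sgraph) : Prop :=
  exists (H : sgraph) (m : nat),
    [/\ 0 < #|H|, bipartite H, 1 <= min_degree H & id_number H = 2]
    /\ 1 <= m /\ graph_iso G (disjoint_union H (edgeless m)).

(* Main.v *)
Require Import Defs.
From mathcomp Require Import all_boot.

Set Implicit Arguments.
Unset Strict Implicit.
Unset Printing Implicit Defensive.

(** Everything depends on whether [G] has a universal vertex, i.e. a vertex [v]
    such that [[set v]] is dominating.

    If it has one, [[set v]] is a class of every ic-partition, because a larger
    class containing [v] is not independent ([universal_class]). In an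
    ic-partition with three classes, the other two are either singletons of
    universal vertices, so that [G] is a triangle, or partners whose union,
    everything except [v], is independent, so that [G] is a star
    ([universal_three_classes]). Both graphs have independent coalition number
    three ([IC_complete], [IC_star]).

    If it has none, every class needs a partner. With three classes some class
    is a partner of both others; it is then nonadjacent to every vertex, so [G]
    has isolated vertices ([three_classes_isolated]). Let [I] be the set of all
    isolated vertices, assumed nonempty. A dominating set contains [I], so every
    coalition does; with at least three classes this forces [I] to be a class
    and the partner of each other class [B], and [I :|: B] is an independent
    dominating set exactly when [B] is one in the graph without [I]
    ([isolated_class]). Conversely, adding the class [I] to an idomatic
    partition of that graph with at least two classes gives an ic-partition of
    [G] ([ic_partition_off]). So ic-partitions in [k >= 3] classes correspond to
    idomatic partitions of the rest in [k - 1] classes, and the number sought is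
    three exactly when the idomatic number of the rest, [id_off G], is two.

    It remains to see that nonempty [I] and [id_off G = 2] characterise the
    family B2 ([in_B2P]): the minimum degree of the rest is automatically
    positive, and its bipartiteness follows from the existence of an idomatic
    partition in two classes. *)

(** * Finite sets, partitions and maxima *)

Lemma max_eqP (T : finType) (p : pred T) (F : T -> nat) k :
  \max_(i | p i) F i = k.+1 <->
  (exists2 i, p i & F i = k.+1) /\ (forall i, p i -> F i <= k.+1).
Proof.
split=> [maxF | [[i pi Fi] leF]]; last first.
  apply/eqP; rewrite eqn_leq -[X in _ && (X <= _)]Fi leq_bigmax_cond // andbT.
  exact/bigmax_leqP.
split; last by apply/bigmax_leqP; rewrite maxF.
have [p0 | /(eq_bigmax_cond F)[i pi maxi]] := posnP #|p|.
  by move: maxF; rewrite big_pred0 // => i; apply: (card0_eq p0).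
by exists i; rewrite // -maxF.
Qed.

Lemma leq_card_partition (T : finType) (P : {set {set T}}) (D : {set T}) :
  partition P D -> #|P| <= #|D|.
Proof.
move=> partP; rewrite (card_partition partP) -sum1_card.
by apply: leq_sum => A AP; rewrite card_gt0 (partition_neq0 partP).
Qed.

Lemma partition_set1 (T : finType) (A : {set T}) :
  A != set0 -> partition [set A] A.
Proof.
by move=> A0; rewrite /partition cover1 eqxx trivIset1 inE eq_sym A0.
Qed.

Lemma partition_singletons (T : finType) :
  partition [set [set x] | x in T] [set: T].
Proof.
have [||+ _] := @indexed_partition T T predT set1.
- by move=> x y _ _ yx; rewrite disjoints1 inE eq_sym.
- by move=> x _; apply/set0Pn; exists x; rewrite set11.
suff -> : cover [set [set x] | x in T] = [set: T] by [].
apply/setP=> x; rewrite inE; apply/bigcupP; exists [set x]; rewrite ?set11 //.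
exact: imset_f.
Qed.

Lemma mem_class (T : finType) (P : {set {set T}}) x :
  partition P [set: T] -> exists2 A, A \in P & x \in A.
Proof.
move=> /cover_partition covP.
have /bigcupP[A AP xA] : x \in cover P by rewrite covP inE.
by exists A.
Qed.

Lemma eq_class (T : finType) (P : {set {set T}}) D A B x :
  partition P D -> A \in P -> B \in P -> x \in A -> x \in B -> A = B.
Proof.
move=> /partition_trivIset tP AP BP xA xB.
by rewrite -(def_pblock tP AP xA) (def_pblock tP BP xB).
Qed.

Lemma card3_eq (T : finType) (P : {set T}) a b c :
  #|P| = 3 -> a \in P -> b \in P -> c \in P -> b != a -> c != a -> c != b ->
  P = [set a; b; c].
Proof.
move=> P3 aP bP cP ba ca cb; apply/esym/eqP; rewrite eqEcard !subUset !sub1set aP bP cP P3.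
by rewrite setUC cardsU1 cards2 !inE (negbTE ca) (negbTE cb) eq_sym ba.
Qed.

(** * Independent domination and coalitions *)

Section Coalitions.

Variable G : sgraph.
Implicit Types (x y v : G) (A B C S X : {set G}) (P : {set {set G}}).

Lemma dominatingP S :
  reflect (forall x, x \notin S -> exists2 y, y \in S & adj x y)
          (dominating S).
Proof.
apply: (iffP forallP) => domS x.
  by move=> /negbTE xS; have := domS x; rewrite xS => /exists_inP.
by have [//|/domS yS] := boolP (x \in S); apply/exists_inP.
Qed.

Lemma independentP S :
  reflect {in S &, forall x y, ~~ adj x y} (independent S).
Proof.
apply: (iffP forall_inP) => [indS x y xS yS | indS x xS].
  exact: (forall_inP (indS x xS)).
by apply/forall_inP=> y yS; apply: indS.
Qed.

Lemma independent_sub A B : A \subset B -> independent B -> independent A.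
Proof.
move=> /subsetP AB /independentP indB.
by apply/independentP=> x y /AB xB /AB yB; apply: indB.
Qed.

Lemma independent1 v : independent [set v].
Proof.
by apply/independentP=> x y /set1P-> /set1P->; rewrite adj_irrefl.
Qed.

Lemma independent_coalition_sym A B :
  independent_coalition A B = independent_coalition B A.
Proof.
rewrite /independent_coalition disjoint_sym setUC.
by congr (_ && _); rewrite andbCA; do 2!congr (_ && _); rewrite andbCA.
Qed.

Lemma dominating1P v :
  reflect (forall x, x != v -> adj x v) (dominating [set v]).
Proof.
apply: (iffP (dominatingP _)) => dom_v x; have := dom_v x; rewrite inE.
  by move=> + xv => /(_ xv)[y /set1P->].
by move=> + xv => /(_ xv); exists v; rewrite ?set11.
Qed.

(** Classes are independent, as singletons or as members of a coalition, and an
    independent set containing the universal vertex [v] has no other vertex. *)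
Lemma universal_class P v :
  ic_partition P -> dominating [set v] -> [set v] \in P.
Proof.
move=> /andP[partP /forall_inP icP] dom_v.
have [A AP vA] := mem_class v partP.
suff <- : A = [set v] by [].
case/orP: (icP A AP) => [/andP[/cards1P[w defA] _] | ].
  by move: vA; rewrite defA => /set1P->.
case/andP=> _ /exists_inP[B _ /andP[_ /and5P[_ /independentP indA _ _ _]]].
apply/setP=> x; rewrite inE; apply/idP/eqP => [xA | -> //].
by apply: contraTeq (indA x v xA vA) => xv; rewrite negbK (dominating1P v dom_v).
Qed.

Lemma class_partner P A :
  ic_partition P -> A \in P -> ~~ ((#|A| == 1) && dominating A) ->
  exists2 B, B \in P & B != A /\ independent_coalition A B.
Proof.
move=> /andP[_ /forall_inP icP] AP nuA; case/orP: (icP A AP).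
  by rewrite (negbTE nuA).
by case/andP=> _ /exists_inP[B BP /andP[BA cAB]]; exists B.
Qed.

Definition isolated : {set G} := [set x | [forall y, ~~ adj x y]].

Lemma isolatedP x : reflect (forall y, ~~ adj x y) (x \in isolated).
Proof. by rewrite inE; apply: forallP. Qed.

Lemma isolated_sub S : dominating S -> isolated \subset S.
Proof.
move=> /dominatingP domS; apply/subsetP=> x /isolatedP isox.
by apply: contraT => /domS[y _]; rewrite (negbTE (isox y)).
Qed.

(** The idomatic partitions of the graph without its isolated vertices, here
    expressed inside [G]: an independent dominating set of that graph becomes
    one of [G] once the isolated vertices are added. This avoids working in a
    subtype until isomorphism classes are compared. *)
Definition idomatic_off P : bool :=
  partition P (~: isolated) &&
  [forall B in P, independent_dominating (isolated :|: B)].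

Definition id_off : nat := \max_(P | idomatic_off P) #|P|.

(** The set of isolated vertices is a partner for every class: by itself it
    dominates nothing else, and no class dominates it. *)
Lemma ic_partition_off P :
  isolated != set0 -> idomatic_off P -> 1 < #|P| ->
  ic_partition (isolated |: P) /\ isolated \notin P.
Proof.
move=> I0 /andP[partP /forall_inP idP] P_gt1.
have disP B : B \in P -> [disjoint isolated & B].
  by move=> BP; rewrite disjoints_subset -setCS setCK (partitionS partP).
have IP : isolated \notin P.
  by apply: contra I0 => /disP; rewrite -setI_eq0 setIid.
split=> //.
have [B0 B0P] : exists B, B \in P by apply/set0Pn; rewrite -card_gt0 ltnW.
have n_idI : ~~ independent_dominating isolated.
  rewrite negb_and; apply/orP; right; apply/negP=> /dominatingP domI.
  have /set0Pn[x xB0] := partition_neq0 partP B0P.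
  have [|y yI] := domI x; first by rewrite (disjointFl (disP _ B0P)).
  by rewrite adj_sym (negbTE (isolatedP _ yI x)).
have coal B : B \in P -> independent_coalition isolated B.
  move=> BP; have /andP[indIB domIB] := idP B BP.
  rewrite /independent_coalition disP // (independent_sub (subsetUl _ _) indIB).
  rewrite (independent_sub (subsetUr _ _) indIB) n_idI idP //= andbT.
  rewrite negb_and; apply/orP; right; apply/negP=> /isolated_sub/setIidPl IB.
  by move: (disP B BP); rewrite -setI_eq0 IB; apply/negP.
apply/andP; split.
  rewrite -(setUCr isolated); apply: partitionU1 => //.
  by rewrite disjoints_subset setCK.
apply/forall_inP=> A /setU1P[-> | AP]; apply/orP; right.
  rewrite n_idI; apply/exists_inP; exists B0; first by rewrite setU1r.
  by rewrite coal // andbT; apply: contraNneq IP => <-.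
have /and5P[_ _ _ _ /andP[-> _]] := coal A AP.
apply/exists_inP; exists isolated; first by rewrite setU11.
rewrite independent_coalition_sym coal // andbT.
by apply: contraNneq IP => ->.
Qed.

(** Every coalition contains all the isolated vertices. Were they spread over
    two classes, every coalition would consist of these two and there would be
    no third class. So they lie in one class [X], which is thus the partner of
    every other class; its union with each of them being independent, the
    vertices of [X] are isolated. *)
Lemma isolated_class P :
  (forall v, ~~ dominating [set v]) -> isolated != set0 -> ic_partition P ->
  2 < #|P| -> isolated \in P /\ idomatic_off (P :\ isolated).
Proof.
move=> no_univ /set0Pn[u uI] icP P_gt2; have /andP[partP _] := icP.
have partner A : A \in P ->
    exists2 B, B \in P & B != A /\ independent_coalition A B.
  move=> AP; apply: (class_partner icP AP).
  by apply: contra (no_univ u) => /andP[/cards1P[v ->]]; rewrite (negbTE (no_univ v)).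
have coalI A B x : independent_coalition A B -> x \in isolated ->
    (x \in A) || (x \in B).
  case/and5P=> _ _ _ _ /and3P[_ _ /isolated_sub/subsetP sI] /sI.
  by rewrite inE.
have [X XP uX] := mem_class u partP.
have has_iso A B Y x : A \in P -> B \in P -> Y \in P ->
    independent_coalition A B -> x \in isolated -> x \in Y -> Y = A \/ Y = B.
  move=> AP BP YP cAB xI xY.
  by case/orP: (coalI A B x cAB xI) => xAB; [left | right];
    apply: (eq_class partP _ _ xY xAB).
have sIX : isolated \subset X.
  apply/subsetP=> v vI; have [Y YP vY] := mem_class v partP.
  have [<- //|YX] := eqVneq Y X.
  suff sPXY : P \subset [set X; Y].
    by have := leq_trans P_gt2 (subset_leq_card sPXY); rewrite cards2; case: eqP.
  apply/subsetP=> C CP; rewrite !inE.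
  have [D DP [DC cCD]] := partner C CP.
  have [-> | XD] := has_iso C D X u CP DP XP cCD uI uX; first by rewrite eqxx.
  have [-> | YD] := has_iso C D Y v CP DP YP cCD vI vY; first by rewrite eqxx orbT.
  by rewrite XD YD eqxx in YX.
have coalX C : C \in P -> C != X -> independent_coalition C X.
  move=> CP CX; have [D DP [DC cCD]] := partner C CP.
  have [XC | -> //] := has_iso C D X u CP DP XP cCD uI uX.
  by rewrite XC eqxx in CX.
have idX C : C \in P -> C != X -> independent_dominating (C :|: X).
  by move=> CP CX; case/and5P: (coalX C CP CX) => _ _ _ _ /andP[].
have [C0 C0P [C0X _]] := partner X XP.
have defX : X = isolated.
  apply/eqP; rewrite eqEsubset sIX andbT; apply/subsetP=> x xX.
  apply/isolatedP=> y; have [C CP yC] := mem_class y partP.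
  have [D DP [DX yD]] : exists2 D, D \in P & D != X /\ y \in D :|: X.
    have [CX | CX] := eqVneq C X; last by exists C; rewrite // inE yC.
    by exists C0; rewrite // inE -{2}CX yC orbT.
  have /andP[/independentP indDX _] := idX D DP DX.
  by apply: indDX => //; rewrite inE xX orbT.
rewrite -defX; split=> //; rewrite /idomatic_off -defX -setTD partitionD1 //=.
by apply/forall_inP=> C /setD1P[CX CP]; rewrite setUC idX.
Qed.

(** A graph on three classes in which each has a partner contains a path, whose
    middle class forms an independent union with every class; so its vertices
    have no neighbour. *)
Lemma three_classes_isolated P :
  (forall v, ~~ dominating [set v]) -> ic_partition P -> #|P| = 3 ->
  isolated != set0.
Proof.
move=> no_univ icP P3; have /andP[partP _] := icP.
have partner A : A \in P ->
    exists2 B, B \in P & B != A /\ independent_coalition A B.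
  move=> AP; apply: (class_partner icP AP); rewrite negb_and.
  by case: eqP => //= /eqP/cards1P[v ->]; apply: no_univ.
have [A AP] : exists A, A \in P by apply/set0Pn; rewrite -card_gt0 P3.
have [B BP [BA cAB]] := partner A AP.
have [C CP /norP[CA CB]] : exists2 C, C \in P & ~~ ((C == A) || (C == B)).
  have : ~~ (P \subset [set A; B]).
    by apply/negP=> /subset_leq_card; rewrite P3 cards2; case: eqP.
  by case/subsetPn=> C CP; rewrite !inE; exists C.
have defP := card3_eq P3 AP BP CP BA CA CB.
have [D DP [DC cCD]] := partner C CP.
have indC (E F : {set G}) : independent_coalition E F -> independent (E :|: F).
  by case/and5P=> _ _ _ _ /and3P[].
(* [X] is the middle of the path: it is the partner of [C], hence [A] or [B],
   which are partners of each other. *)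
have [X [Y [Z [sP [XP indXY indXZ]]]]] : exists X Y Z,
    (forall E, E \in P -> [\/ E = X, E = Y | E = Z]) /\
    [/\ X \in P, independent (X :|: Y) & independent (X :|: Z)].
  move: DP; rewrite {1}defP !inE (negbTE DC) orbF => /orP[]/eqP eqD.
    exists A, B, C; split.
      move=> E; rewrite defP !inE -orbA => /or3P[]/eqP->;
        by [apply: Or31 | apply: Or32 | apply: Or33].
    by rewrite AP (indC _ _ cAB) setUC -eqD (indC _ _ cCD).
  exists B, A, C; split.
    move=> E; rewrite defP !inE -orbA => /or3P[]/eqP->;
      by [apply: Or31 | apply: Or32 | apply: Or33].
  by rewrite BP setUC (indC _ _ cAB) setUC -eqD (indC _ _ cCD).
have /set0Pn[x xX] := partition_neq0 partP XP.
apply/set0Pn; exists x; apply/isolatedP=> y.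
have [E EP yE] := mem_class y partP.
by case: (sP E EP) => defE; rewrite defE in yE;
  [apply: (independentP _ indXY) | apply: (independentP _ indXY) |
   apply: (independentP _ indXZ)]; rewrite inE ?xX ?yE ?orbT.
Qed.

(** * Graphs with a universal vertex *)

(** A class other than singletons of universal vertices has a partner, and
    both avoid the universal vertex [v]; so [v] and the two partners are the
    three classes, and the union of the partners is independent. *)
Lemma universal_three_classes P v :
  ic_partition P -> #|P| = 3 -> dominating [set v] ->
  (#|G| = 3 /\ forall x y, adj x y = (x != y)) \/
  (exists c : G, forall x y, adj x y = ((x == c) != (y == c))).
Proof.
move=> icP P3 dom_v; have vP := universal_class icP dom_v.
have /andP[partP _] := icP.
have [/forall_inP allu | ] :=
    boolP [forall A in P, (#|A| == 1) && dominating A].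
  left; split.
    rewrite -cardsT (@card_uniform_partition _ 1 P) ?P3 ?muln1 //.
    by move=> A /allu/andP[/eqP].
  move=> x y; have [<- | xy] := eqVneq x y; first exact: adj_irrefl.
  have [A AP yA] := mem_class y partP.
  have /andP[/cards1P[w defA]] := allu A AP.
  move: yA; rewrite defA => /set1P<- /dominating1P; exact.
rewrite negb_forall_in => /exists_inP[A AP nuA]; right; exists v.
have [B BP [BA cAB]] := class_partner icP AP nuA.
have /and5P[_ _ _ nidA /and3P[nidB indAB _]] := cAB.
have id_v : independent_dominating [set v].
  by rewrite /independent_dominating independent1.
have Av : A != [set v] by apply: contraNneq nidA => ->.
have Bv : B != [set v] by apply: contraNneq nidB => ->.
have defP := card3_eq P3 vP AP BP Av Bv BA.
have AB x : x != v -> x \in A :|: B.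
  move=> xv; have [C CP xC] := mem_class x partP.
  by move: CP xC; rewrite defP !inE -orbA => /or3P[]/eqP->;
    rewrite ?inE ?(negbTE xv) // => ->; rewrite ?orbT.
move=> x y; have [-> | xv] := eqVneq x v; have [-> | yv] := eqVneq y v.
- exact: adj_irrefl.
- by rewrite adj_sym (dominating1P _ dom_v).
- by rewrite (dominating1P _ dom_v).
- by apply/negbTE/(independentP _ indAB); apply: AB.
Qed.

Lemma IC_complete :
  #|G| = 3 -> (forall x y, adj x y = (x != y)) -> IC G = 3.
Proof.
move=> G3 adjG; apply/max_eqP; split; last first.
  by move=> P /andP[/leq_card_partition]; rewrite cardsT G3.
exists [set [set x] | x in G]; last by rewrite (card_imset _ set1_inj).
rewrite /ic_partition partition_singletons; apply/forall_inP=> A.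
case/imsetP=> x _ ->; rewrite cards1 eqxx; apply/orP; left.
by apply/dominating1P=> y; rewrite adjG.
Qed.

(** A dominating set avoiding the centre contains every leaf. So besides the
    class of the centre, two classes forming a coalition already use up all the
    leaves, and conversely any splitting of the leaves in two nonempty parts is
    a coalition. *)
Lemma IC_star (c : G) :
  2 < #|G| -> (forall x y, adj x y = ((x == c) != (y == c))) -> IC G = 3.
Proof.
move=> G_gt2 adjG.
have dom_c : dominating [set c].
  by apply/dominating1P=> x xc; rewrite adjG eqxx (negbTE xc).
have dom_leaves S : c \notin S -> dominating S -> S = ~: [set c].
  move=> cS /dominatingP domS; apply/setP=> x; rewrite !inE.
  have [-> | xc] := eqVneq x c; first exact: negbTE.
  apply: contraT => /domS[y yS].
  have yc : y != c by apply: contraNneq cS => <-.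
  by rewrite adjG (negbTE xc) (negbTE yc).
have card_leaves : 1 < #|~: [set c]|.
  by move: G_gt2; rewrite -(cardsC [set c]) cards1.
apply/max_eqP; split; last first.
  move=> P icP; have cP := universal_class icP dom_c.
  have /andP[partP _] := icP.
  have [sPc | /subsetPn[A AP]] := boolP (P \subset [set [set c]]).
    by apply: leq_trans (subset_leq_card sPc) _; rewrite cards1.
  rewrite inE => Ac.
  have cnot B : B \in P -> B != [set c] -> c \notin B.
    by move=> BP; apply: contra => cB; rewrite (eq_class partP BP cP cB) ?set11.
  have nuA : ~~ ((#|A| == 1) && dominating A).
    apply/negP=> /andP[/eqP A1 domA]; move: card_leaves.
    by rewrite -(dom_leaves A) ?A1 ?cnot.
  have [B BP [_ cAB]] := class_partner icP AP nuA.
  have /and5P[_ _ _ _ /and3P[nidB indAB domAB]] := cAB.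
  have Bc : B != [set c].
    apply: contraNneq nidB => ->.
    by rewrite /independent_dominating independent1.
  have defAB : A :|: B = ~: [set c].
    by apply: dom_leaves; rewrite // inE negb_or !cnot.
  suff sP : P \subset [set [set c]; A; B].
    apply: leq_trans (subset_leq_card sP) _.
    by rewrite setUC cardsU1 cards2; case: (_ \notin _); case: (_ != _).
  apply/subsetP=> C CP; have /set0Pn[x xC] := partition_neq0 partP CP.
  have : (x == c) || (x \in A :|: B) by rewrite defAB !inE orbN.
  rewrite !inE => /or3P[/eqP xc | xA | xB].
  - by rewrite (eq_class partP CP cP xC) ?eqxx // xc set11.
  - by rewrite (eq_class partP CP AP xC xA) eqxx orbT.
  - by rewrite (eq_class partP CP BP xC xB) eqxx !orbT.
have /set0Pn[a] : ~: [set c] != set0 by rewrite -card_gt0 ltnW.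
rewrite !inE => ac; set L := ~: [set c; a].
have L0 : L != set0.
  rewrite -card_gt0; move: G_gt2; rewrite -(cardsC [set c; a]) cards2.
  by rewrite eq_sym ac.
have aL : [set a] != L.
  by apply/eqP=> /setP/(_ a); rewrite !inE eqxx orbT.
have cardP : #|[set c] |: ([set a] |: [set L])| = 3.
  rewrite !cardsU1 cards1 !inE (negbTE aL).
  have -> : ([set c] == [set a]) = false.
    by rewrite (inj_eq set1_inj) eq_sym (negbTE ac).
  suff -> : ([set c] == L) = false by [].
  by apply/eqP=> /setP/(_ c); rewrite !inE eqxx.
exists ([set c] |: ([set a] |: [set L])) => //.
have ind_leaves : independent (~: [set c]).
  apply/independentP=> x y; rewrite !inE adjG.
  by move=> /negbTE-> /negbTE->.
have defaL : [set a] :|: L = ~: [set c].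
  by apply/setP=> x; rewrite !inE; have [-> | ] := eqVneq x a; rewrite ?ac ?orbF.
have coal : independent_coalition [set a] L.
  rewrite /independent_coalition /independent_dominating independent1 /=.
  rewrite defaL ind_leaves disjoints1 !inE eqxx orbT /=.
  rewrite (independent_sub _ ind_leaves) -?defaL ?subsetUr //= defaL.
  apply/and3P; split.
  - apply/negP=> /dom_leaves; rewrite inE eq_sym => /(_ ac) a_leaves.
    by move: card_leaves; rewrite -a_leaves cards1.
  - apply/negP=> /dom_leaves; rewrite !inE eqxx => /(_ isT) /setP/(_ a).
    by rewrite !inE eqxx orbT ac.
  apply/dominatingP=> x; rewrite !inE negbK => /eqP->.
  by exists a; rewrite ?inE // adjG eqxx (negbTE ac).
apply/andP; split.
  have -> : [set: G] = [set c] :|: ([set a] :|: L) by rewrite defaL setUCr.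
  apply: partitionU1; last by rewrite defaL disjoints1 !inE eqxx.
    apply: partitionU1; first exact: partition_set1.
      by rewrite -card_gt0 cards1.
    by rewrite disjoints1 !inE eqxx orbT.
  by rewrite -card_gt0 cards1.
have /and5P[_ _ _ nida /andP[nidL _]] := coal.
apply/forall_inP=> A; rewrite !inE => /or3P[]/eqP->; apply/orP.
- by left; rewrite cards1 dom_c.
- right; rewrite nida; apply/exists_inP; exists L; rewrite ?inE ?eqxx ?orbT //.
  by rewrite eq_sym aL.
right; rewrite nidL; apply/exists_inP; exists [set a].
  by rewrite !inE eqxx orbT.
by rewrite aL independent_coalition_sym.
Qed.

(** * Graphs with isolated vertices *)

(** An idomatic partition of the rest in two classes gives three classes in [G],
    while more than three classes in [G] would leave more than two for the rest.
    There is no universal vertex, since it would have to be isolated and yet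
    adjacent to the vertices of the rest. *)
Lemma IC_isolated : isolated != set0 -> id_off = 2 -> IC G = 3.
Proof.
move=> I0 /max_eqP[[P offP P2] le2].
have [icIP IP] := ic_partition_off I0 offP (eq_leq (esym P2)).
have /andP[partP _] := offP.
have no_univ v : ~~ dominating [set v].
  apply/negP=> dom_v.
  move: (isolated_sub dom_v); rewrite subset1 (negbTE I0) orbF => /eqP defI.
  have vI : v \in isolated by rewrite defI set11.
  have [B BP] : exists B, B \in P by apply/set0Pn; rewrite -card_gt0 P2.
  have /set0Pn[x xB] := partition_neq0 partP BP.
  have xv : x != v.
    by have := subsetP (partitionS partP BP) x xB; rewrite defI !inE.
  by have := isolatedP _ vI x; rewrite adj_sym (dominating1P _ dom_v).
apply/max_eqP; split; first by exists (isolated |: P); rewrite // cardsU1 IP P2.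
move=> Q icQ; rewrite leqNgt; apply/negP=> Q_gt3.
have [IQ /le2] := isolated_class no_univ I0 icQ (ltnW Q_gt3).
by rewrite leqNgt; move: Q_gt3; rewrite (cardsD1 isolated) IQ add1n ltnS => ->.
Qed.

(** An idomatic partition of the rest in more than two classes, together with
    the class of isolated vertices, would have more than three classes. *)
Lemma id_off_of_IC :
  (forall v, ~~ dominating [set v]) -> IC G = 3 -> isolated != set0 /\ id_off = 2.
Proof.
move=> no_univ /max_eqP[[P icP P3] le3].
have I0 := three_classes_isolated no_univ icP P3; split=> //.
have [IP offP] := isolated_class no_univ I0 icP (eq_leq (esym P3)).
apply/max_eqP; split.
  by exists (P :\ isolated) => //; move: P3; rewrite (cardsD1 isolated) IP => -[].
move=> Q offQ; rewrite leqNgt; apply/negP=> Q_gt2.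
have [icIQ IQ] := ic_partition_off I0 offQ (ltnW Q_gt2).
by move: (le3 _ icIQ); rewrite cardsU1 IQ add1n ltnNge Q_gt2.
Qed.

End Coalitions.

(** * Isomorphism types *)

(** Isomorphisms onto a graph built on a sum of types are easier to build
    backwards, by enumerating each part of the sum inside [G]. *)
Lemma graph_iso_of_inj (G H : sgraph) (h : H -> G) :
  injective h -> #|G| <= #|H| -> (forall x y, adj (h x) (h y) = adj x y) ->
  graph_iso G H.
Proof.
move=> hI cardGH adjh; have [f hK fK] := inj_card_bij hI cardGH.
by exists f => [|x y]; [exists h | rewrite -adjh !fK].
Qed.

Lemma graph_iso_completeP (G : sgraph) n :
  graph_iso G (complete n) <-> #|G| = n /\ forall x y : G, adj x y = (x != y).
Proof.
split=> [[f bij_f adjf] | [Gn adjG]].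
  split=> [|x y]; first by rewrite (bij_eq_card bij_f) card_ord.
  by rewrite -adjf /= /complete_rel (inj_eq (bij_inj bij_f)).
subst n; apply: (@graph_iso_of_inj G (complete _) enum_val).
- exact: enum_val_inj.
- by rewrite card_ord.
- by move=> x y; rewrite adjG (inj_eq enum_val_inj).
Qed.

Lemma graph_iso_starP (G : sgraph) :
  0 < #|G| ->
  graph_iso G (complete_bip 1 (#|G| - 1)) <->
  exists c : G, forall x y : G, adj x y = ((x == c) != (y == c)).
Proof.
move=> G0; split=> [[f [g fK gK] adjf] | [c adjG]].
  exists (g (inl ord0)) => x y.
  have centre z : (z == g (inl ord0)) = (if f z is inl _ then true else false).
    rewrite -(can_eq fK) gK; case: (f z) => [i|//]; by rewrite [i]ord1 eqxx.
  by rewrite !centre -adjf; case: (f x) => ?; case: (f y).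
have card_leaves : #|G| - 1 = #|~: [set c]|.
  by rewrite -(cardsC [set c]) cards1 addKn.
rewrite card_leaves.
pose h (u : complete_bip 1 #|~: [set c]|) : G :=
  match u with inl _ => c | inr i => enum_val i end.
have leaf (i : 'I_#|~: [set c]|) : (enum_val i == c) = false.
  by apply/negbTE; have := enum_valP i; rewrite !inE.
apply: (@graph_iso_of_inj _ _ h).
- move=> [i|i] [j|j] //=; first by rewrite (ord1 i) (ord1 j).
  + by move/esym/eqP; rewrite leaf.
  + by move/eqP; rewrite leaf.
  + by move/enum_val_inj->.
- by rewrite card_sum !card_ord -card_leaves subnKC.
- by move=> [i|i] [j|j]; rewrite adjG /= ?eqxx ?leaf.
Qed.

(** Isolated vertices have to belong to a dominating set, but neither dominate
    other vertices nor spoil independence. Here [H] is a copy of the graph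
    without the isolated vertices of [G]. *)
Lemma independent_dominating_off (G H : sgraph) (h : H -> G) :
  injective h -> (forall x y, adj (h x) (h y) = adj x y) ->
  h @: [set: H] = ~: isolated G ->
  forall B : {set H}, independent_dominating (isolated G :|: h @: B) =
            independent_dominating B.
Proof.
move=> hI adjh imh B.
have iso_h x : (h x \in isolated G) = false.
  apply/negbTE; rewrite -in_setC -imh; exact: imset_f.
have in_h y : y \notin isolated G -> exists x, y = h x.
  by rewrite -in_setC -imh => /imsetP[x _ ->]; exists x.
congr (_ && _).
  apply/independentP/independentP => indB x y.
    by move=> xB yB; rewrite -adjh indB // inE imset_f ?orbT.
  case/setUP=> [/isolatedP xI _ | /imsetP[x' xB ->]]; first exact: xI.
  case/setUP=> [/isolatedP yI | /imsetP[y' yB ->]]; first by rewrite adj_sym yI.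
  by rewrite adjh indB.
apply/dominatingP/dominatingP => domB x.
  move=> xB; have [|y] := domB (h x); first by rewrite inE iso_h mem_imset.
  case/setUP=> [/isolatedP/(_ (h x)) | /imsetP[z zB ->]].
    by rewrite adj_sym => /negbTE->.
  by rewrite adjh; exists z.
rewrite inE negb_or => /andP[/in_h[z ->]]; rewrite mem_imset // => /domB[y yB zy].
by exists (h y); rewrite ?adjh // inE imset_f ?orbT.
Qed.

(** Images under [h] of idomatic partitions of [H], and preimages in the other
    direction, match the two families of partitions class by class. *)
Lemma id_off_embedding (G H : sgraph) (h : H -> G) :
  injective h -> (forall x y, adj (h x) (h y) = adj x y) ->
  h @: [set: H] = ~: isolated G -> id_off G = id_number H.
Proof.
move=> hI adjh imh; have idh := independent_dominating_off hI adjh imh.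
pose img (P : {set {set H}}) := [set h @: A | A : {set H} in P].
have img_off P : idomatic_off (img P) = idomatic_partition P.
  rewrite /idomatic_off -imh imset_partition //; congr (_ && _).
  apply/forall_inP/forall_inP => idP B.
    by move=> BP; rewrite -idh idP ?imset_f.
  by case/imsetP=> A AP ->; rewrite idh idP.
have card_img P : #|img P| = #|P| by rewrite card_imset //; apply: imset_inj.
apply/eqP; rewrite eqn_leq; apply/andP; split; apply/bigmax_leqP => P idomP.
  have defP : P = img [set h @^-1: A | A : {set G} in P].
    have imK A : A \in P -> h @: (h @^-1: A) = A.
      move=> AP; apply/setP=> y; apply/imsetP/idP => [[x + ->]|yA].
        by rewrite inE.
      have /andP[partP _] := idomP.
      have := subsetP (partitionS partP AP) y yA.
      by rewrite -imh => /imsetP[x _ defy]; exists x; rewrite // inE -defy.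
    rewrite /img -imset_comp -[LHS]imset_id.
    by apply: eq_in_imset => A AP /=; rewrite imK.
  by rewrite defP card_img leq_bigmax_cond // -img_off -defP.
by rewrite -card_img; apply: leq_bigmax_cond; rewrite img_off.
Qed.

Lemma min_degree_gt0P (G : sgraph) :
  0 < #|G| -> 1 <= min_degree G <-> isolated G = set0.
Proof.
move=> G0; have degP x : (0 < degree x) = (x \notin isolated G).
  rewrite card_gt0; apply/set0Pn/idP => [[y]| ].
    by rewrite inE => xy; apply/negP=> /isolatedP/(_ y)/negP.
  by rewrite inE negb_forall => /existsP[y]; rewrite negbK; exists y; rewrite inE.
split=> [degG | I0].
  apply/setP=> x; rewrite in_set0; apply/negbTE; rewrite -degP.
  apply: leq_trans degG _; rewrite /min_degree.
  elim: (index_enum _) (mem_index_enum x) => // y r IHr.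
  rewrite inE big_cons geq_min => /orP[/eqP-> | /IHr->]; last exact: orbT.
  by rewrite leqnn.
rewrite /min_degree; elim/big_ind: _ => // [m n m0 n0|x _].
  by rewrite leq_min m0.
by rewrite degP I0 inE.
Qed.

Section Induced.

Variables (G : sgraph) (S : {set G}).

Definition induced_rel : rel {x | x \in S} := fun x y => adj (val x) (val y).
Lemma induced_sym : symmetric induced_rel.
Proof. by move=> x y; apply: adj_sym. Qed.
Lemma induced_irrefl : irreflexive induced_rel.
Proof. by move=> x; apply: adj_irrefl. Qed.
Definition induced : sgraph := SGraph induced_sym induced_irrefl.

End Induced.

(** In the presentation [H] + edgeless the edgeless part is the set of isolated
    vertices, because [H] has none; conversely the graph induced on the
    non-isolated vertices serves as [H], any of its idomatic partitions in two
    classes being a bipartition. *)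
Lemma in_B2P (G : sgraph) :
  in_B2 G <-> isolated G != set0 /\ id_off G = 2.
Proof.
split=> [[H [m [[H0 bipH degH idH] [m0 [f [g fK gK] adjf]]]]] | [I0 id2]].
  have noI := (min_degree_gt0P H0).1 degH.
  have adjg u v : adj (g u) (g v) = adj u v by rewrite -adjf !gK.
  have iso_inr i : g (inr i) \in isolated G.
    by apply/isolatedP=> y; rewrite -(fK y) adjg; case: (f y).
  have iso_inl x : g (inl x) \notin isolated G.
    have : x \notin isolated H by rewrite noI inE.
    apply: contra => /isolatedP gx; apply/isolatedP=> y.
    by have := gx (g (inl y)); rewrite adjg.
  split; first by apply/set0Pn; exists (g (inr (Ordinal m0))).
  rewrite (@id_off_embedding G H (g \o inl)) //.
  - by move=> x y /(can_inj gK)[].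
  - by move=> x y; rewrite /= adjg.
  apply/setP=> y; rewrite inE; apply/imsetP/idP => [[x _ ->]|].
    exact: iso_inl.
  rewrite -(fK y); case: (f y) => [x _ | i]; first by exists x.
  by rewrite iso_inr.
pose H := induced (~: isolated G).
have imH : (val : H -> G) @: [set: H] = ~: isolated G.
  apply/setP=> x; apply/imsetP/idP => [[u _ ->]| xI]; first exact: (valP u).
  by exists (Sub x xI).
have idH : id_number H = 2.
  by rewrite -id2; apply/esym/(id_off_embedding _ _ imH) => //; apply: val_inj.
have [[P /andP[partP /forall_inP idP] P2] _] := (max_eqP _ _ _).1 idH.
have /eqP/cards2P[A [B [_ defP]]] := P2.
have AP : A \in P by rewrite defP set21.
have BP : B \in P by rewrite defP set22.
have H0 : 0 < #|H|.
  have /set0Pn[x _] := partition_neq0 partP AP.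
  by apply/card_gt0P; exists x.
exists H, #|isolated G|; split; last first.
  split; first by rewrite card_gt0.
  pose h (u : disjoint_union H (edgeless #|isolated G|)) : G :=
    match u with inl x => val x | inr i => enum_val i end.
  have iso_inl (x : H) : (val x \in isolated G) = false.
    by apply/negbTE; have := valP x; rewrite in_setC.
  apply: (@graph_iso_of_inj _ _ h).
  - move=> [x|i] [y|j] //=.
    + by move/val_inj->.
    + by move=> xj; have := enum_valP j; rewrite -xj iso_inl.
    + by move=> iy; have := enum_valP i; rewrite iy iso_inl.
    + by move/enum_val_inj->.
  - rewrite card_sum card_ord -(cardsC (isolated G)) addnC leq_add2r.
    by rewrite card_sig.
  - move=> [x|i] [y|j] //=; apply/negbTE.
    + by rewrite adj_sym; apply: isolatedP; apply: enum_valP.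
    + by apply: isolatedP; apply: enum_valP.
    + by apply: isolatedP; apply: enum_valP.
split=> //.
  exists A; have /andP[-> _] := idP A AP; split=> //.
  have /andP[indB _] := idP B BP; apply: independent_sub indB.
  apply/subsetP=> x xA; have [C CP xC] := mem_class x partP.
  by move: CP xC xA; rewrite defP !inE => /orP[]/eqP-> // ->.
apply/(min_degree_gt0P H0)/eqP; rewrite -subset0; apply/subsetP=> x.
move=> /isolatedP xI; have := valP x; rewrite in_setC => /isolatedP[] y.
apply/negP=> xy; suff yI : y \in ~: isolated G.
  by have := xI (Sub y yI); rewrite [adj _ _]xy.
by rewrite in_setC; apply/negP=> /isolatedP/(_ (val x)); rewrite adj_sym xy.
Qed.

Theorem proposition4p7 (G : sgraph) (n : nat)
  (G_nonempty : 0 < #|G|) (order_G : #|G| = n) :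
  IC G = 3 <->
  graph_iso G (complete 3)
  \/ (3 <= n /\ graph_iso G (complete_bip 1 (n - 1)))
  \/ in_B2 G.
Proof.
subst n; split.
  move=> IC3; have [[P icP P3] _] := (max_eqP _ _ _).1 IC3.
  have [/existsP[v dom_v]|] := boolP [exists v : G, dominating [set v]].
    have [K3 | star] := universal_three_classes icP P3 dom_v.
      by left; apply/graph_iso_completeP.
    right; left; split; last exact/graph_iso_starP.
    by rewrite -P3 -cardsT; have /andP[/leq_card_partition] := icP.
  rewrite negb_exists => /forallP no_univ.
  by right; right; apply/in_B2P/id_off_of_IC.
case=> [/graph_iso_completeP[G3 adjG] | ]; first exact: IC_complete.
case=> [[G_gt2 /(graph_iso_starP G_nonempty)[c adjG]] | /in_B2P[I0 id2]].
  exact: IC_star adjG.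
exact: IC_isolated.
Qed.
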